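(* For every $\tau\in(0,1)$ there exist a matrix $A\in\mathbb{R}^{2\times 2}$ (with target rank $r=1$) and a $(1,1,1/2)$-OSI $\Omega\in\mathbb{R}^{2\times 1}$ such that the randomized SVD approximation $\widetilde A=(A\Omega)(A\Omega)^+A$ satisfies \[ \|A-\widetilde A\|_F = \sqrt{\frac{2}{1+\tau^2}}\,\min_{\operatorname{rank}(B)\le 1}\|A-B\|_F \qquad\text{almost surely.} \] In particular, the ratio $\|A-\widetilde A\|_F/\min_{\operatorname{rank}(B)\le 1}\|A-B\|_F$ tends to $\sqrt{2}$ as $\tau\to 0$.
   Context: Definition (oblivious subspace injection, OSI). Fix integers $1\le s\le n$ and $k\ge1$, an injectivity parameter $\alpha\in(0,1]$, and a failure parameter $\rho\in[0,1)$. A random matrix $\Omega\in\mathbb{R}^{n\times k}$ is an $(s,\alpha,\rho)$-OSI if (i) (isotropy) $\mathbb{E}[\Omega\Omega^\top]=I_n$; and (ii) (injectivity) for every fixed $s$-dimensional subspace $V\subseteq\mathbb{R}^n$, $\mathbb{P}\{\|\Omega^\top x\|_2^2\ge\alpha\|x\|_2^2\text{ for all }x\in V\}\ge1-\rho$. Notation: ${}^+$ denotes the Moore--Penrose pseudoinverse and $\|\cdot\|_F$ the Frobenius norm. The minimum is over $B\in\mathbb{R}^{2\times2}$ with rank at most $1$. *)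

(* Defs.v *)
From HB Require Import structures.
From mathcomp Require Import all_boot all_order all_algebra.
From mathcomp Require Import all_classical all_reals all_analysis.

Set Implicit Arguments.
Unset Strict Implicit.
Unset Printing Implicit Defensive.

Import Order.TTheory GRing.Theory Num.Theory.
Import numFieldNormedType.Exports.

Local Open Scope classical_set_scope.
Local Open Scope ring_scope.

(* The library norm on matrices is the max norm. On a column vector
   [frob_norm] is the Euclidean norm. *)
Definition frob_norm (R : realType) m n (A : 'M[R]_(m, n)) : R :=
  Num.sqrt (\sum_i \sum_j A i j ^+ 2).

(* [X] satisfies the four Penrose equations for [A]. *)
Definition penrose (R : realType) m n (A : 'M[R]_(m, n)) (X : 'M[R]_(n, m)) :=
  [/\ A *m X *m A = A,
      X *m A *m X = X,
      (A *m X)^T = A *m X &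
      (X *m A)^T = X *m A].

(* Not the same as [pinvmx], which is only a partial inverse. The default
   value of [xget] is never used: see [mp_pinvP]. *)
Definition mp_pinv (R : realType) m n (A : 'M[R]_(m, n)) : 'M[R]_(n, m) :=
  xget 0 [set X | penrose A X].

Lemma penrose_uniq (R : realType) m n (A : 'M[R]_(m, n)) X Y :
  penrose A X -> penrose A Y -> X = Y.
Proof.
move=> [AXA XAX AXt XAt] [AYA YAY AYt YAt].
have AXY : A *m X = A *m Y.
  rewrite -AXt -{1}AYA -(mulmxA (A *m Y) A X) trmx_mul AXt AYt mulmxA.
  by rewrite AXA.
have XYA : X *m A = Y *m A.
  rewrite -XAt -{1}AYA !mulmxA -(mulmxA (X *m A) Y A) trmx_mul XAt YAt.
  by rewrite -mulmxA (mulmxA A) AXA.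
by rewrite -XAX XYA -mulmxA AXY mulmxA YAY.
Qed.

Lemma gram_unit (R : realType) m n (B : 'M[R]_(m, n)) :
  row_free B -> B *m B^T \in unitmx.
Proof.
move=> Bfree; rewrite -row_free_unit; apply: inj_row_free => v vBB.
have : (v *m B) *m (v *m B)^T = 0.
  by rewrite trmx_mul mulmxA -(mulmxA v) vBB mul0mx.
move=> /matrixP /(_ 0 0); rewrite !mxE => /eqP.
rewrite psumr_eq0; last by move=> j _; rewrite [X in _ * X]mxE -expr2 sqr_ge0.
move=> /allP s0; apply: (row_free_inj Bfree); rewrite mul0mx.
apply/rowP => j; move: (s0 j (mem_index_enum _)).
by rewrite [X in _ * X]mxE -expr2 sqrf_eq0 => /eqP ->; rewrite mxE.
Qed.

Lemma mp_pinvP (R : realType) m n (A : 'M[R]_(m, n)) : penrose A (mp_pinv A).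
Proof.
suff [X AX] : exists X, penrose A X by exact: (xgetI 0 (x := X)).
have [r [C [B [AE uC uB]]]] : exists r (C : 'M[R]_(m, r)) (B : 'M[R]_(r, n)),
    [/\ A = C *m B, C^T *m C \in unitmx & B *m B^T \in unitmx].
  exists (\rank A), (col_base A), (row_base A); split.
  - by rewrite mulmx_base.
  - rewrite -{2}(trmxK (col_base A)); apply: gram_unit.
    by rewrite /row_free mxrank_tr -/(row_full _) col_base_full.
  - exact/gram_unit/row_base_free.
exists (B^T *m invmx (B *m B^T) *m invmx (C^T *m C) *m C^T).
set G := invmx (B *m B^T); set H := invmx (C^T *m C).
have GT : G^T = G by rewrite trmx_inv trmx_mul trmxK.
have HT : H^T = H by rewrite trmx_inv trmx_mul trmxK.
have AX : A *m (B^T *m G *m H *m C^T) = C *m H *m C^T.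
  by rewrite AE !mulmxA -(mulmxA C B) -(mulmxA C) mulmxV // mulmx1.
have XA : B^T *m G *m H *m C^T *m A = B^T *m G *m B.
  by rewrite AE !mulmxA -(mulmxA _ C^T C) -(mulmxA _ H) mulVmx // mulmx1.
split.
- by rewrite AX AE !mulmxA -(mulmxA _ C^T C) -(mulmxA _ H) mulVmx // mulmx1.
- by rewrite XA !mulmxA -(mulmxA _ B B^T) -(mulmxA _ (B *m B^T)) mulmxV // mulmx1.
- by rewrite AX !trmx_mul trmxK HT !mulmxA.
- by rewrite XA !trmx_mul trmxK GT !mulmxA.
Qed.

(* Real-valued matrices carry no canonical sigma-algebra in the library. *)
Definition random_matrix d (T : measurableType d) (R : realType) n k
    (Omega : T -> 'M[R]_(n, k)) : Prop :=
  forall i j, measurable_fun setT (fun w => Omega w i j).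

Record is_OSI d (T : measurableType d) (R : realType) (P : probability T R)
    n k (s : nat) (alpha rho : R) (Omega : T -> 'M[R]_(n, k)) : Prop := {
  OSI_dim : (1 <= s <= n)%N ;
  OSI_cols : (1 <= k)%N ;
  OSI_alpha : 0 < alpha <= 1 ;
  OSI_rho : 0 <= rho < 1 ;
  OSI_random : random_matrix Omega ;
  (* finiteness of the expectations forces integrability of the entries *)
  OSI_isotropy : forall i j : 'I_n,
    ('E_P[(fun w => (Omega w *m (Omega w)^T) i j)%R])%E =
      ((1%:M : 'M[R]_n) i j)%:E ;
  OSI_injectivity : forall V : {vspace 'cV[R]_n}, \dim V = s ->
    ((1 - rho)%:E <=
     P [set w | forall x : 'cV[R]_n, x \in V ->
          (alpha * frob_norm x ^+ 2 <= frob_norm ((Omega w)^T *m x) ^+ 2)%R])%E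
}.

Definition rsvd (R : realType) m n k (A : 'M[R]_(m, n))
    (Omega : 'M[R]_(n, k)) : 'M[R]_(m, n) :=
  A *m Omega *m mp_pinv (A *m Omega) *m A.

Definition rank_errors (R : realType) m n (r : nat) (A : 'M[R]_(m, n)) :
    set R :=
  [set frob_norm (A - B) | B in [set B : 'M[R]_(m, n) | (\rank B <= r)%N]].

(* An infimum; that it is a minimum is the membership
   [rank_errors r A (best_rank_error r A)]. *)
Definition best_rank_error (R : realType) m n (r : nat) (A : 'M[R]_(m, n)) : R :=
  inf (rank_errors r A).

(* Main.v *)
(* Take A = diag(1, tau) and Omega = (1, +-1)^T with a fair random sign. For a
   fixed x, <Omega, x>^2 = |x|^2 +- 2 x_0 x_1 is at least |x|^2 for one of the
   two signs, hence with probability at least 1/2. Both signs give the same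
   error: projecting A onto the line of (1, +-tau) leaves a squared error of
   2 tau^2 / (1 + tau^2), while the best rank-one error is tau. *)

Require Import Defs.
From HB Require Import structures.
From mathcomp Require Import all_boot all_order all_algebra.
From mathcomp Require Import all_classical all_reals all_analysis.
From mathcomp Require Import ring lra.

Set Implicit Arguments.
Unset Strict Implicit.
Unset Printing Implicit Defensive.

Import Order.TTheory GRing.Theory Num.Theory.
Import numFieldNormedType.Exports.

Local Open Scope classical_set_scope.
Local Open Scope ring_scope.

Lemma frob_norm_sqr (R : realType) m n (A : 'M[R]_(m, n)) :
  frob_norm A ^+ 2 = \sum_i \sum_j A i j ^+ 2.
Proof.
rewrite sqr_sqrtr// sumr_ge0// => i _.
by rewrite sumr_ge0// => j _; rewrite sqr_ge0.
Qed.

(* Also valid at [y = 0], where both sides are [0] because [0^-1 = 0]. *)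
Lemma mp_pinv_col (R : realType) m (y : 'cV[R]_m) :
  mp_pinv y = (frob_norm y ^+ 2)^-1 *: y^T.
Proof.
apply: penrose_uniq (mp_pinvP y) _.
set c := frob_norm y ^+ 2.
have yTy : y^T *m y = c%:M.
  apply/matrixP => i j; rewrite !ord1 !mxE eqxx /c frob_norm_sqr mulr1n.
  by apply: eq_bigr => k _; rewrite big_ord1 !mxE.
have [c0|c0] := eqVneq c 0.
  have y0 : y = 0.
    have : c == 0 by rewrite c0.
    rewrite /c frob_norm_sqr psumr_eq0.
      move=> /allP s0; apply/colP => i; move: (s0 i (mem_index_enum _)).
      by rewrite big_ord1 sqrf_eq0 => /eqP ->; rewrite mxE.
    by move=> i _; rewrite big_ord1 sqr_ge0.
  by rewrite c0 y0 invr0 scale0r; split; rewrite ?mulmx0 ?mul0mx ?trmx0.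
split.
- rewrite -scalemxAr -scalemxAl -mulmxA yTy mul_mx_scalar.
  by rewrite scalerA mulVf// scale1r.
- rewrite -!(scalemxAl, scalemxAr) yTy mul_scalar_mx.
  by rewrite (scalerA c^-1 c) mulVf// scale1r.
- by rewrite -scalemxAr linearZ/= trmx_mul trmxK.
- by rewrite -scalemxAl linearZ/= trmx_mul trmxK.
Qed.

Definition diag1t (R : realType) (tau : R) : 'M[R]_2 :=
  diag_mx (\row_j tau ^+ j).

(** The outer exponent is the row index, 0 or 1, so the first entry is always 1; [true] encodes the
    sign -1. *)
Definition sign_col (R : realType) (b : bool) : 'cV[R]_2 :=
  \col_i ((-1) ^+ b) ^+ i.

Lemma big_ord2 (V : nmodType) (F : 'I_2 -> V) : \sum_i F i = F 0 + F 1.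
Proof.
by rewrite !big_ord_recl big_ord0 addr0; congr (F _ + F _); exact: val_inj.
Qed.

(** A singular [B] kills some row vector [v != 0]. Hence [v (A - B) = v A], whose length is at least
    [tau |v|] and at most [|v|] times the Frobenius norm of [A - B]. *)
Lemma diag1t_rank_error_ge (R : realType) (tau : R) (B : 'M[R]_2) :
  0 <= tau <= 1 -> (\rank B <= 1)%N -> tau <= frob_norm (diag1t tau - B).
Proof.
move=> /andP[t0 t1] rB.
have /det0P[v v0 vB] : \det B == 0.
  rewrite -[_ == 0]negbK -unitfE -[\det B \is a GRing.unit]/(B \in unitmx).
  by rewrite -row_free_unit /row_free; apply: contraTN rB => /eqP->.
rewrite -(@ler_pXn2r _ 2) ?nnegrE ?sqrtr_ge0// frob_norm_sqr.
have := congr1 (fun M : 'rV[R]_2 => M 0 0) vB.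
have := congr1 (fun M : 'rV[R]_2 => M 0 1) vB.
rewrite !mxE !big_ord2 !mxE /= expr0 expr1 !mulr1n !mulr0n !sub0r !sqrrN.
set a := B 0 0; set b := B 0 1; set c := B 1 0; set d := B 1 1.
set p := v 0 0; set q := v 0 1 => vd vc.
have n0 : 0 < p ^+ 2 + q ^+ 2.
  rewrite lt_neqAle addr_ge0 ?sqr_ge0// andbT eq_sym.
  apply: contra_neq v0 => /eqP; rewrite paddr_eq0 ?sqr_ge0// !sqrf_eq0.
  move=> /andP[/eqP p0 /eqP q0]; apply/rowP => j; rewrite mxE.
  case: j => [[|[|//]] j2]; [rewrite -p0|rewrite -q0];
    by congr (v 0 _); exact/val_inj.
rewrite -(ler_pM2l n0).
(* Cauchy-Schwarz for [v = (p, q)] against each column of [A - B], in the form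
   of Lagrange's identity. *)
have -> : (p ^+ 2 + q ^+ 2) *
    ((1 - a) ^+ 2 + b ^+ 2 + (c ^+ 2 + (tau - d) ^+ 2)) =
    (p - (p * a + q * c)) ^+ 2 + (p * c + q * (1 - a)) ^+ 2 +
    ((q * tau - (p * b + q * d)) ^+ 2 + (p * (tau - d) + q * b) ^+ 2) by ring.
rewrite vc vd !subr0 mulrDl -!exprMn.
(* Dropping the second square of each pair leaves [(p * tau) ^+ 2 <= p ^+ 2], which is where
   [tau <= 1] enters. *)
rewrite lerD// -[leLHS]addr0 lerD ?sqr_ge0//.
by rewrite exprMn ler_piMr ?sqr_ge0// exprn_ile1.
Qed.

(** The sign affects only the off-diagonal entries of the residual, and only through their signs, so
    it disappears after squaring. *)
Lemma rsvd_diag1t (R : realType) (tau : R) (b : bool) :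
  frob_norm (diag1t tau - rsvd (diag1t tau) (sign_col R b)) =
    Num.sqrt (2 / (1 + tau ^+ 2)) * `|tau|.
Proof.
have y2 : frob_norm (diag1t tau *m sign_col R b) ^+ 2 = 1 + tau ^+ 2.
  rewrite frob_norm_sqr !(big_ord2, big_ord1, mxE) /=.
  rewrite !expr0 !expr1 !mulr1n !mulr0n.
  by case: b; rewrite ?expr0 ?expr1; ring.
have N0 : 1 + tau ^+ 2 != 0 :> R by rewrite gt_eqF// ltr_pwDl// sqr_ge0.
rewrite -sqrtr_sqr -sqrtrM; last by rewrite divr_ge0// addr_ge0// sqr_ge0.
congr Num.sqrt; rewrite /rsvd mp_pinv_col y2.
rewrite !(big_ord2, big_ord1, mxE) /=.
rewrite !expr0 !expr1 !mulr1n !mulr0n.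
by case: b {y2}; rewrite ?expr0 ?expr1; field.
Qed.

(** Splitting [f] into positive and negative parts reduces to nonnegative integrands. Isotropy needs
    the signed case, for its off-diagonal entries. *)
Lemma integral_bernoulli_prob_EFin (R : realType) (p : R) (f : bool -> R) :
  0 <= p <= 1 ->
  (\int[bernoulli_prob p]_b (f b)%:E = (p * f true + (1 - p) * f false)%:E)%E.
Proof.
move=> p01; rewrite integralE.
under eq_integral do rewrite funeposE -EFin_max.
under [X in (_ - X)%E]eq_integral do rewrite funenegE -EFinN -EFin_max.
rewrite !integral_bernoulli_prob;
  try by [move=> ?; rewrite lee_fin le_max lexx orbT|].
rewrite -!EFinM -!EFinD; congr EFin.
have maxB (x : R) : Num.max x 0 - Num.max (- x) 0 = x.
  by case: (leP x 0) => x0; case: (leP (- x) 0) => y0; lra.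
rewrite -[f true in RHS]maxB -[f false in RHS]maxB /unstable.onem; ring.
Qed.

Lemma frob_norm_sign_col (R : realType) (b : bool) (x : 'cV[R]_2) :
  frob_norm ((sign_col R b)^T *m x) ^+ 2 =
    frob_norm x ^+ 2 + 2 * ((-1) ^+ b * (x 0 0 * x 1 0)).
Proof.
rewrite !frob_norm_sqr !(big_ord2, big_ord1, mxE) /= expr0 expr1.
by case: b; rewrite ?expr0 ?expr1; ring.
Qed.

Lemma sign_col_OSI (R : realType) :
  is_OSI (bernoulli_prob (2^-1 : R)) 1 1 (1 / 2) (sign_col R).
Proof.
have half01 : 0 <= (2^-1 : R) <= 1 by lra.
split=> //; [lra|lra| |].
- move=> i j; rewrite unlock.
  (* For indices in {0, 1}, [i + j] is even exactly when [i = j]: the mean is 1 on the diagonal and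
     0 off it. *)
  transitivity (\int[bernoulli_prob (2^-1 : R)]_b
      (((-1 : R) ^+ b) ^+ (i + j))%:E)%E.
    by apply: eq_integral => b _; rewrite !mxE big_ord1 !mxE -exprD.
  rewrite integral_bernoulli_prob_EFin//; congr EFin.
  case: i j => [[|[|//]] i2] [[|[|//]] j2];
    by rewrite mxE/= ?expr0 ?expr1 ?expr1n; field.
- move=> V dimV; set v := vpick V.
  have Vv : V = <[v]>%VS.
    apply/eqP; rewrite eq_sym eqEdim -memvE memv_pick dimV dim_vline.
    by rewrite /v vpick0 -dimv_eq0 dimV.
  (* The sign that makes the cross term of [v] nonnegative. The cross term of [k *: v] is [k ^+ 2]
     times that of [v], so this one outcome, of mass 1/2, serves the whole line [V]. *)
  set b := v 0 0 * v 1 0 < 0.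
  have sv : 0 <= (-1) ^+ b * (v 0 0 * v 1 0).
    rewrite /b; case: ltP => ? /=; rewrite ?expr0 ?expr1; lra.
  have <- : bernoulli_prob (2^-1 : R) [set b] = (1 - 1 / 2)%:E.
    rewrite bernoulli_probE//= !diracE !classical_sets.in_set1 /unstable.onem.
    by rewrite -!EFinM -EFinD; congr (_%:E); case: (b) => /=; field.
  apply: le_measure; rewrite ?inE// => _ -> x /=; rewrite Vv => /vlineP[k ->].
  rewrite mul1r frob_norm_sign_col lerDl mulr_ge0// !mxE.
  by rewrite (mulrACA k) -expr2 (mulrCA ((-1) ^+ b)) mulr_ge0// sqr_ge0.
Qed.

Lemma diag1t_rank_error (R : realType) (tau : R) : 0 <= tau <= 1 ->
  rank_errors 1 (diag1t tau) tau.
Proof.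
(* Keeping only the leading singular value 1 leaves the single entry [tau]. *)
move=> /andP[t0 t1]; exists (delta_mx 0 0); first by rewrite /= mxrank_delta.
rewrite -[RHS]ger0_norm// -sqrtr_sqr; congr Num.sqrt.
rewrite !(big_ord2, mxE) /= expr0 expr1 !mulr1n !mulr0n; ring.
Qed.

Lemma best_rank_error_diag1t (R : realType) (tau : R) : 0 <= tau <= 1 ->
  best_rank_error 1 (diag1t tau) = tau.
Proof.
move=> t01; have lbt : lbound (rank_errors 1 (diag1t tau)) tau.
  by move=> _ [B rB <-]; exact: diag1t_rank_error_ge.
apply/le_anti/andP; split.
  by apply: ge_inf (diag1t_rank_error t01); exists tau.
by apply: lb_le_inf lbt; exists tau; exact: diag1t_rank_error.
Qed.

Theorem theorem4p1 (R : realType) :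
  exists (d : measure_display) (T : measurableType d) (P : probability T R)
         (A : R -> 'M[R]_(2, 2)) (Omega : R -> T -> 'M[R]_(2, 1)),
    (forall tau : R, 0 < tau < 1 ->
      [/\ is_OSI P 1 1 (1 / 2) (Omega tau),
          rank_errors 1 (A tau) (best_rank_error 1 (A tau)),
          0 < best_rank_error 1 (A tau) &
          {ae P, forall w,
            frob_norm (A tau - rsvd (A tau) (Omega tau w)) =
              Num.sqrt (2 / (1 + tau ^+ 2)) * best_rank_error 1 (A tau)}]) /\
    {ae P, forall w,
      frob_norm (A tau - rsvd (A tau) (Omega tau w)) /
        best_rank_error 1 (A tau) @[tau --> 0^'+] --> Num.sqrt (2 : R)}.
Proof.
(* The same random column serves every [tau], so the limit can be taken at a fixed outcome; both
   almost sure claims hold at every outcome. *)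
exists _, _, (bernoulli_prob (2^-1 : R)), (@diag1t R), (fun=> sign_col R).
split=> [tau /andP[t0 t1]|].
  have t01 : 0 <= tau <= 1 by rewrite !ltW.
  split; rewrite ?best_rank_error_diag1t//.
  - exact: sign_col_OSI.
  - exact: diag1t_rank_error.
  - by apply: aeW => b; rewrite rsvd_diag1t ger0_norm ?ltW.
apply: aeW => b.
apply: (@cvg_trans _ (Num.sqrt (2 / (1 + tau ^+ 2)) @[tau --> 0^'+])).
  apply: near_eq_cvg; near=> tau.
  have t0 : 0 < tau by [].
  have t1 : tau < 1 by near: tau; exact: nbhs_right_lt.
  rewrite rsvd_diag1t best_rank_error_diag1t ?ltW//.
  by rewrite ger0_norm ?ltW// mulfK// gt_eqF.
apply: cvg_at_right_filter.
(* The limit is the value at [tau = 0] of a function continuous there. *)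
have -> : Num.sqrt 2 = Num.sqrt (2 / (1 + 0 ^+ 2)) :> R.
  by rewrite expr0n addr0 divr1.
apply: continuous_comp; last exact: sqrt_continuous.
apply: cvgM; first exact: cvg_cst.
apply: cvgV; first by rewrite expr0n addr0 oner_neq0.
apply: cvgD; first exact: cvg_cst.
exact: exprn_continuous.
Unshelve. all: by end_near.
Qed.
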